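(* Let $\phi:\mathbb{R}^d\to\mathbb{R}$ be bounded below, twice continuously differentiable, with $M$-Lipschitz continuous gradient ($M>0$), and $m$-strongly convex with $0<m\le M$. Let $f:\mathbb{R}^d\to\mathbb{R}$, $g:\mathbb{R}^d\to\mathbb{R}^d$ and constants $\epsilon_f,\epsilon_g\ge 0$ satisfy $|f(x)-\phi(x)|\le\epsilon_f$ and $\|g(x)-\nabla\phi(x)\|\le\epsilon_g$ for all $x\in\mathbb{R}^d$. Let $\{x_k\}$, $\{p_k\}$ be generated by the BFGS method with errors (described in the context) with constants $0<c_1<c_2<1$ and lengthening parameter $l>0$ satisfying $l>2\epsilon_g/m$. Fix $q\in(0,1)$ and let $\beta_1$ and the index set $J$ be as defined in the context. Choose $\delta_1,\delta_2,\widehat\delta_1,\widehat\delta_2\in(0,1)$ such that $\delta_1+\delta_2<c_2-c_1$, $\widehat\delta_1<c_1$ and $\widehat\delta_2<1-c_2$. If $k\in J$ and $$\|\nabla\phi(x_k)\|\ge\max\left\{A\frac{\sqrt{M\epsilon_f}}{\beta_1},\ B\frac{\epsilon_g}{\beta_1}\right\},$$ where $$A=\max\left\{\sqrt{\frac{32}{(1-c_2+\delta_2)\delta_1}},\ \sqrt{\frac{32}{\widehat\delta_1(1-c_2)}}\right\},$$ $$B=\max\left\{\frac{4(c_1+\delta_1)}{\delta_1},\ \frac{2(1+c_2-\delta_2)}{\delta_2},\ \frac{8}{1-c_2},\ \frac{4c_1}{\widehat\delta_1},\ \frac{2(1+c_2)}{\widehat\delta_2}\right\},$$ then there exists a stepsize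 $\alpha_k>0$ such that $$f(x_k+\alpha_kp_k)\le f(x_k)+c_1\alpha_kp_k^Tg(x_k),\qquad p_k^Tg(x_k+\alpha_kp_k)\ge c_2\,p_k^Tg(x_k),$$ and any such stepsize also satisfies $$\phi(x_k+\alpha_kp_k)\le\phi(x_k)+(c_1-\widehat\delta_1)\alpha_kp_k^T\nabla\phi(x_k),\qquad p_k^T\nabla\phi(x_k+\alpha_kp_k)\ge(c_2+\widehat\delta_2)\,p_k^T\nabla\phi(x_k),$$ and in addition $$\phi(x_{k+1})-\phi(x_k)\le-\frac{(c_1-\widehat\delta_1)\left[1-(c_2+\widehat\delta_2)\right]\beta_1^2}{4M}\|\nabla\phi(x_k)\|^2.$$
   Context: $\|\cdot\|$ is the Euclidean norm; $\mathbb{N}=\{0,1,2,\dots\}$. BFGS method with errors. Inputs: $f$, $g$, constants $0<c_1<c_2<1$, lengthening parameter $l>0$, starting point $x_0\in\mathbb{R}^d$, symmetric positive definite $H_0\in\mathbb{R}^{d\times d}$. For $k=0,1,2,\dots$: (1) $p_k=-H_kg(x_k)$. (2) Line search: if there exists $\alpha>0$ such that $f(x_k+\alpha p_k)\le f(x_k)+c_1\alpha p_k^Tg(x_k)$ and $p_k^Tg(x_k+\alpha p_k)\ge c_2p_k^Tg(x_k)$, then $\alpha_k$ is set to some such $\alpha$ (any one of them); otherwise $\alpha_k=0$. (3) If $\|\alpha_kp_k\|\ge l$, set $s_k=\alpha_kp_k$; otherwise set $s_k=l\,p_k/\|p_k\|$. In both cases $y_k=g(x_k+s_k)-g(x_k)$.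 (4) $H_{k+1}=(I-\rho_ks_ky_k^T)H_k(I-\rho_ky_ks_k^T)+\rho_ks_ks_k^T$ with $\rho_k=1/(s_k^Ty_k)$. (5) $x_{k+1}=x_k+\alpha_kp_k$. It is understood that $g(x_k)\ne0$ for all $k$, so that all steps are defined. Constants: $B_0=H_0^{-1}$, $\widehat m=m-2\epsilon_g/l$, $\widehat M=M+2\epsilon_g/l$, $$\beta_0=\frac{1}{1-q}\left[\mathrm{tr}(B_0)-\log\det(B_0)+\widehat M-1-\log\widehat m\right],\qquad \beta_1=e^{-\beta_0/2}\in(0,1).$$ Good iterates: $J=\{j\in\mathbb{N}:\cos\theta_j\ge\beta_1\}$, where $\theta_j$ is the angle between $p_j$ and $-g(x_j)$, i.e. $\cos\theta_j=-p_j^Tg(x_j)/(\|p_j\|\|g(x_j)\|)$. *)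

(* Defs.v *)
From HB Require Import structures.
From mathcomp Require Import all_boot all_order all_algebra.
From mathcomp Require Import all_classical all_reals all_analysis.

Set Implicit Arguments.
Unset Strict Implicit.
Unset Printing Implicit Defensive.

Import Order.TTheory GRing.Theory Num.Theory.
Import numFieldNormedType.Exports.
Local Open Scope classical_set_scope.
Local Open Scope ring_scope.

Section Euclidean.
Context {R : realType} {d : nat}.
Implicit Types (u v x : 'cV[R]_d) (phi : 'cV[R]_d -> R).

Definition dotv u v : R := (u^T *m v) 0 0.

(* The library norm on matrices is the sup norm, so the Euclidean norm has to
   be introduced. Both norms induce the same topology, so [differentiable] and
   [continuous] below have their usual meaning. *)
Definition enorm v : R := Num.sqrt (dotv v v).

Definition grad phi x : 'cV[R]_d := \col_i 'D_(delta_mx i 0) phi x.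

Definition hessian phi x : 'M[R]_d :=
  \matrix_(i, j) 'D_(delta_mx j 0) (fun z => grad phi z i 0) x.

Definition twice_cont_differentiable phi : Prop :=
  [/\ forall x, differentiable phi x,
      forall x, differentiable (grad phi) x
    & continuous (hessian phi)].

(* [_.-lipschitz] of the library refers to the sup norm. *)
Definition elipschitz (M : R) (F : 'cV[R]_d -> 'cV[R]_d) : Prop :=
  forall x y, enorm (F x - F y) <= M * enorm (x - y).

Definition strongly_convex (m : R) phi : Prop :=
  forall x y (t : R), 0 <= t -> t <= 1 ->
    phi (t *: x + (1 - t) *: y) <=
      t * phi x + (1 - t) * phi y - m / 2 * t * (1 - t) * enorm (x - y) ^+ 2.

Definition symmetric_posdef (H : 'M[R]_d) : Prop :=
  H^T = H /\ forall v, v != 0 -> 0 < dotv v (H *m v).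

End Euclidean.

Section BFGS.
Context {R : realType} {d : nat}.
Implicit Types (f : 'cV[R]_d -> R) (g : 'cV[R]_d -> 'cV[R]_d).
Implicit Types (H : 'M[R]_d) (s y p : 'cV[R]_d).

Definition armijo_cond f g (c1 : R) (x p : 'cV[R]_d) (a : R) : Prop :=
  f (x + a *: p) <= f x + c1 * a * dotv p (g x).

Definition wolfe_cond g (c2 : R) (x p : 'cV[R]_d) (a : R) : Prop :=
  dotv p (g (x + a *: p)) >= c2 * dotv p (g x).

Definition armijo_wolfe f g (c1 c2 : R) (x p : 'cV[R]_d) (a : R) : Prop :=
  armijo_cond f g c1 x p a /\ wolfe_cond g c2 x p a.

Definition bfgs_update H s y : 'M[R]_d :=
  let rho := (dotv s y)^-1 in
  (1%:M - rho *: (s *m y^T)) *m H *m (1%:M - rho *: (y *m s^T))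
    + rho *: (s *m s^T).

(* [g (x k) != 0] is the standing convention that the iteration never stops. *)
Record bfgs_with_errors f g (c1 c2 l : R) (x0 : 'cV[R]_d) (H0 : 'M[R]_d)
    (x p s y : nat -> 'cV[R]_d) (H : nat -> 'M[R]_d) (alpha : nat -> R) : Prop :=
  BfgsWithErrors {
    bfgs_x0 : x 0%N = x0;
    bfgs_H0 : H 0%N = H0;
    bfgs_g_neq0 : forall k, g (x k) != 0;
    bfgs_p : forall k, p k = - (H k *m g (x k));
    bfgs_search : forall k,
      (exists2 a, 0 < a & armijo_wolfe f g c1 c2 (x k) (p k) a) ->
      0 < alpha k /\ armijo_wolfe f g c1 c2 (x k) (p k) (alpha k);
    bfgs_search_fail : forall k,
      ~ (exists2 a, 0 < a & armijo_wolfe f g c1 c2 (x k) (p k) a) ->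
      alpha k = 0;
    bfgs_s : forall k,
      s k = if l <= enorm (alpha k *: p k) then alpha k *: p k
            else (l / enorm (p k)) *: p k;
    bfgs_y : forall k, y k = g (x k + s k) - g (x k);
    bfgs_H : forall k, H k.+1 = bfgs_update (H k) (s k) (y k);
    bfgs_x : forall k, x k.+1 = x k + alpha k *: p k
  }.

Definition mhat (m eps_g l : R) : R := m - 2 * eps_g / l.
Definition Mhat (M eps_g l : R) : R := M + 2 * eps_g / l.

Definition beta0 (m M eps_g l q : R) (H0 : 'M[R]_d) : R :=
  let B0 := invmx H0 in
  (1 - q)^-1 *
    (\tr B0 - ln (\det B0) + Mhat M eps_g l - 1 - ln (mhat m eps_g l)).

Definition beta1 (m M eps_g l q : R) (H0 : 'M[R]_d) : R :=
  expR (- beta0 m M eps_g l q H0 / 2).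

Definition cos_theta g (x p : 'cV[R]_d) : R :=
  - dotv p (g x) / (enorm p * enorm (g x)).

Definition good_iterates g (x p : nat -> 'cV[R]_d) (b1 : R) : set nat :=
  [set j | cos_theta g (x j) (p j) >= b1].

End BFGS.

Section Constants.
Context {R : realType}.

Definition constA (c2 delta1 delta2 hdelta1 : R) : R :=
  Num.max (Num.sqrt (32 / ((1 - c2 + delta2) * delta1)))
          (Num.sqrt (32 / (hdelta1 * (1 - c2)))).

Definition constB (c1 c2 delta1 delta2 hdelta1 hdelta2 : R) : R :=
  Num.max (4 * (c1 + delta1) / delta1)
  (Num.max (2 * (1 + c2 - delta2) / delta2)
  (Num.max (8 / (1 - c2))
  (Num.max (4 * c1 / hdelta1)
           (2 * (1 + c2) / hdelta2)))).

End Constants.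

(* Main.v *)
Require Import Defs.
From HB Require Import structures.
From mathcomp Require Import all_boot all_order all_algebra.
From mathcomp Require Import all_classical all_reals all_analysis.
From mathcomp Require Import ring lra.

Set Implicit Arguments.
Unset Strict Implicit.
Unset Printing Implicit Defensive.

Import Order.TTheory GRing.Theory Num.Theory.
Import numFieldNormedType.Exports.
Local Open Scope classical_set_scope.
Local Open Scope ring_scope.

(* Write K = beta_1 |grad phi(x_k)| and P = |p_k|. The lower bound on the
   gradient norm makes eps_g a small fraction of K, so the slopes of g and of
   grad phi along p_k are both at most -3/4 P K and differ by at most eps_g P;
   likewise eps_f is a small fraction of K^2 / M. The curvature condition and
   Lipschitz continuity force a step of length at least of order K / M, whose
   decrease dominates 2 eps_f. Hence the Armijo and Wolfe conditions pass between
   the pairs (f, g) and (phi, grad phi) at the price of the margins delta_i.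
   Exact Wolfe steps with parameters c_1 + delta_1 and c_2 - delta_2 give steps for
   (f, g), and steps for (f, g) are transferred back to (phi, grad phi) with the
   margins hdelta_i. *)

(** * Euclidean inner product and norm, derivatives along lines, slope estimates *)

Section EuclideanTheory.
Context {R : realType} {d : nat}.
Implicit Types (u v w x : 'cV[R]_d).

Lemma dotvE u v : dotv u v = \sum_i u i 0 * v i 0.
Proof. by rewrite /dotv mxE; apply: eq_bigr => i _; rewrite mxE. Qed.

Lemma dotvC u v : dotv u v = dotv v u.
Proof. by rewrite !dotvE; apply: eq_bigr => i _; rewrite mulrC. Qed.

Lemma dotvDr u v w : dotv u (v + w) = dotv u v + dotv u w.
Proof. by rewrite /dotv mulmxDr mxE. Qed.

Lemma dotvZr u a v : dotv u (a *: v) = a * dotv u v.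
Proof. by rewrite /dotv -scalemxAr mxE. Qed.

Lemma dotvBr u v w : dotv u (v - w) = dotv u v - dotv u w.
Proof. by rewrite -[- w]scaleN1r dotvDr dotvZr mulN1r. Qed.

Lemma dotv_ge0 u : 0 <= dotv u u.
Proof. by rewrite dotvE; apply: sumr_ge0 => i _; rewrite -expr2 sqr_ge0. Qed.

Lemma enorm_ge0 u : 0 <= enorm u.
Proof. exact: sqrtr_ge0. Qed.

Lemma enorm_sqr u : enorm u ^+ 2 = dotv u u.
Proof. by rewrite sqr_sqrtr ?dotv_ge0. Qed.

Lemma enorm_eq0 u : (enorm u == 0) = (u == 0).
Proof.
apply/idP/eqP => [/eqP u0|->]; last first.
  by rewrite /enorm /dotv mulmx0 mxE sqrtr0.
have /eqP : dotv u u = 0 by rewrite -enorm_sqr u0 expr0n.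
rewrite dotvE psumr_eq0 => [/allP uu0|i _]; last by rewrite -expr2 sqr_ge0.
apply/colP => i; rewrite mxE; apply/eqP.
by have := uu0 i (mem_index_enum i); rewrite /= mulf_eq0 orbb.
Qed.

Lemma enormZ a u : enorm (a *: u) = `|a| * enorm u.
Proof.
by rewrite /enorm dotvZr dotvC dotvZr mulrA -expr2 sqrtrM ?sqr_ge0// sqrtr_sqr.
Qed.

(** For nonzero [v], the squared norm of [dotv v v *: u - dotv u v *: v] is nonnegative and equals
    [dotv v v] times the defect of the squared inequality. *)
Lemma dotv_cauchy_schwarz u v : `|dotv u v| <= enorm u * enorm v.
Proof.
have [->|v0] := eqVneq v 0.
  by rewrite /dotv mulmx0 mxE normr0 mulr_ge0 ?enorm_ge0.
have V0 : 0 < dotv v v.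
  by rewrite -enorm_sqr exprn_gt0// lt_def enorm_eq0 v0 enorm_ge0.
rewrite -ler_sqr ?nnegrE ?mulr_ge0 ?enorm_ge0//.
rewrite real_normK ?num_real// exprMn !enorm_sqr.
have := dotv_ge0 (dotv v v *: u - dotv u v *: v).
rewrite dotvBr !dotvZr ![dotv (_ - _) _]dotvC !dotvBr !dotvZr (dotvC v u).
rewrite -(pmulr_rge0 (_ - _) V0); set a := (X in _ <= X -> _) => a0.
rewrite -subr_ge0 -(pmulr_rge0 _ (mulr_gt0 V0 V0)); apply: le_trans a0 _.
by rewrite le_eqVlt; apply/orP; left; apply/eqP; rewrite /a; ring.
Qed.

Lemma enorm_triangle u v : enorm (u + v) <= enorm u + enorm v.
Proof.
rewrite -ler_sqr ?nnegrE ?addr_ge0 ?enorm_ge0//.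
rewrite sqrrD !enorm_sqr dotvDr ![dotv (_ + _) _]dotvC !dotvDr (dotvC v u).
have := le_trans (ler_norm _) (dotv_cauchy_schwarz u v); lra.
Qed.

Lemma derive_grad (phi : 'cV[R]_d -> R) x v :
  differentiable phi x -> 'D_v phi x = dotv v (grad phi x).
Proof.
move=> dphi; rewrite deriveE// dotvE {1}[v]matrix_sum_delta linear_sum /=.
apply: eq_bigr => i _; rewrite big_ord1 linearZ /= mxE deriveE//.
Qed.

Lemma is_derive_line (phi : 'cV[R]_d -> R) x v (t : R) :
  differentiable phi (x + t *: v) ->
  is_derive t 1 (fun r => phi (x + r *: v)) (dotv v (grad phi (x + t *: v))).
Proof.
move=> dphi; have dv := @diff_derivable _ _ _ _ _ v dphi.
(* The difference quotient of the restriction to the line is literally that of [phi] in direction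
   [v], so no chain rule is needed. *)
have E : (fun h : R => h^-1 *: (((fun r => phi (x + r *: v)) \o shift t)
            (h *: 1) - phi (x + t *: v)))
     = (fun h : R => h^-1 *: ((phi \o shift (x + t *: v)) (h *: v)
            - phi (x + t *: v))).
  apply/funext => h /=; congr (_ *: (phi _ - _)).
  by rewrite scalerDl [_%R *: 1]mulr1 addrCA.
split; first by rewrite /derivable E.
by rewrite -derive_grad// /derive E.
Qed.

Lemma dotv_lipschitz (F : 'cV[R]_d -> 'cV[R]_d) M x v (a : R) :
  elipschitz M F -> 0 <= a ->
  dotv v (F (x + a *: v)) - dotv v (F x) <= M * a * enorm v ^+ 2.
Proof.
move=> FM a0; rewrite -dotvBr.
apply: le_trans (ler_norm _) (le_trans (dotv_cauchy_schwarz _ _) _).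
have := FM (x + a *: v) x.
rewrite [x + _ - x]addrAC subrr add0r enormZ ger0_norm// => FMx.
by have := ler_wpM2l (enorm_ge0 v) FMx; rewrite !mulrA; lra.
Qed.

Lemma dotv_error u v w eps :
  enorm (v - w) <= eps -> `|dotv u v - dotv u w| <= eps * enorm u.
Proof.
move=> vw; rewrite -dotvBr; apply: le_trans (dotv_cauchy_schwarz _ _) _.
by rewrite mulrC ler_wpM2r ?enorm_ge0.
Qed.

End EuclideanTheory.

(** * Exact Wolfe steps for a function of one variable *)

Section LineSearch.
Context {R : realType}.

Lemma derive_lt0_decreases (h : R -> R) (a dh T : R) :
  is_derive a 1 h dh -> dh < 0 -> a < T -> exists2 t, a < t < T & h t < h a.
Proof.
move=> hd dh0 aT.
have : (fun t => t^-1 *: ((h \o shift a) (t *: 1) - h a)) @ 0^' --> dh.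
  rewrite -(@derive_val _ _ _ _ _ _ _ hd).
  exact: (@ex_derive _ _ _ _ _ _ _ hd).
move=> /cvg_dnbhs_at_right/cvgr_lt/(_ _ dh0) Hlt.
have Ta : 0 < T - a by rewrite subr_gt0.
have [t [t0 tT ht]] : exists t : R, [/\ 0 < t, t < T - a &
    t^-1 *: ((h \o shift a) (t *: 1) - h a) < 0].
  by near (0 : R)^'+ => t; exists t; split; near: t;
    [exact: nbhs_right_gt|exact: nbhs_right_lt|].
exists (t + a); first by lra.
move: ht; rewrite /= [_%R *: 1]mulr1 [_ *: _]mulrC.
by rewrite pmulr_llt0 ?invr_gt0// subr_lt0.
Unshelve. all: by end_near. Qed.

(* The minimiser of [t |-> psi t - c t psi'(0)] on a long enough interval is
   interior. *)
Lemma wolfe_step_exists (psi dpsi : R -> R) (c : R) :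
  0 < c < 1 -> (forall t : R, is_derive t 1 psi (dpsi t)) ->
  has_lbound (range psi) -> dpsi 0 < 0 ->
  exists2 a, 0 < a & psi a <= psi 0 + c * a * dpsi 0 /\ dpsi a = c * dpsi 0.
Proof.
move=> /andP[c0 c1] dP [L Lpsi] d0.
set e := - (c * dpsi 0).
have e0 : 0 < e by rewrite oppr_gt0 nmulr_llt0.
pose h t := psi t + e * t.
have dh (t : R) : is_derive t 1 h (dpsi t + e).
  have -> : h = psi + e \*: id by [].
  by apply: is_derive_eq; rewrite [_ *: 1]mulr1.
have Lp t : L <= psi t by apply: Lpsi; exists t.
(* This length gives [h T >= psi 0 + 1], so the right endpoint is not a minimiser. *)
set T := (psi 0 - L + 1) / e.
have T0 : 0 < T by rewrite divr_gt0//; have := Lp 0; lra.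
have hT : h 0 < h T.
  by rewrite /h /T [e * (_ / _)]mulrC divfK ?gt_eqF// mulr0; have := Lp T; lra.
have ch : {within `[0, T], continuous h}.
  apply: derivable_within_continuous => t _.
  exact: (@ex_derive _ _ _ _ _ _ _ (dh t)).
have [a aT amin] := EVT_min (ltW T0) ch.
(* The initial slope of [h] is [(1 - c) * dpsi 0], so [h] dips below [h 0] and the left endpoint is
   excluded as well. *)
have dh0 : dpsi 0 + e < 0 by rewrite /e; nra.
have [t /andP[t0 tT] ht] := derive_lt0_decreases (dh 0) dh0 T0.
have hat : h a <= h t by apply: amin; rewrite in_itv/= !ltW.
have a0 : 0 < a.
  move: aT; rewrite in_itv/= le_eqVlt => /andP[/orP[/eqP a0|//] _].
  by move: ht hat; rewrite -a0; lra.
have aT' : a \in `]0, T[.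
  move: aT; rewrite !in_itv/= a0 /= => /andP[_]; rewrite le_eqVlt.
  by move=> /orP[/eqP aT|//]; move: ht hat; rewrite aT; lra.
(* The Armijo inequality is [h a < h 0]; the slope equation is the vanishing of the derivative of
   [h] at [a]. *)
exists a => //; split.
  by have := le_lt_trans hat ht; rewrite /h /e; lra.
have := derive1_at_min (ltW T0)
  (fun t _ => @ex_derive _ _ _ _ _ _ _ (dh t)) aT'
  (fun t tT => amin t (subset_itv_oo_cc tT)).
move=> [_]; rewrite (@derive_val _ _ _ _ _ _ _ (dh a)) => /eqP.
by rewrite addr_eq0 /e opprK => /eqP.
Qed.

End LineSearch.

(** * Passing the line search conditions between nearby pairs of function and gradient *)

Section WolfeTransfer.
Context {R : realType} {d : nat}.
Implicit Types (f : 'cV[R]_d -> R) (g : 'cV[R]_d -> 'cV[R]_d) (x p : 'cV[R]_d).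

(* The last hypothesis is the lower bound on the step coming from curvature:
   5/8 = 7/8 - 2/8, where 7/8 P K bounds the slope of [g] and 2/8 accounts for the
   errors of [g] at both ends of the step. *)
Lemma armijo_transfer f1 f2 g1 g2 (eps_f eps_g M K kappa c delta a : R) x p :
  0 < M -> 0 < K -> 0 < c -> 0 < delta -> 0 < a ->
  (forall z, `|f1 z - f2 z| <= eps_f) ->
  (forall z, enorm (g1 z - g2 z) <= eps_g) ->
  4 * c * eps_g <= delta * K -> 32 * M * eps_f <= kappa * delta * K ^+ 2 ->
  3 / 4 * enorm p * K <= - dotv p (g2 x) ->
  5 / 8 * kappa * K <= M * a * enorm p ->
  armijo_cond f1 g1 c x p a -> armijo_cond f2 g2 (c - delta) x p a.
Proof.
move=> M0 K0 c0 delta0 a0 fe ge eg ef D2 step; rewrite /armijo_cond => f1a.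
have P0 := enorm_ge0 p.
have := fe x; have := fe (x + a *: p); have := dotv_error p (ge x).
rewrite !ler_norml => /andP[_ D12] /andP[fa _] /andP[_ fx].
set D := - dotv p (g2 x) in D2; set P := enorm p in P0 D2 step D12.
have aD : 3 / 4 * a * P * K <= a * D by nra.
have MaPK : 5 / 8 * kappa * K ^+ 2 <= M * a * P * K by nra.
have eps_aPK : 32 * eps_f <= 8 / 5 * delta * (a * P * K).
  rewrite -(ler_pM2l M0).
  have : delta * (5 / 8 * kappa * K ^+ 2) <= delta * (M * a * P * K).
    by rewrite ler_wpM2l// ltW.
  lra.
have epsP : c * a * (dotv p (g1 x) - dotv p (g2 x)) <= delta / 4 * (a * P * K).
  have E1 : c * a * (dotv p (g1 x) - dotv p (g2 x)) <= c * a * (eps_g * P).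
    by rewrite ler_wpM2l// ltW// mulr_gt0.
  have : (4 * c * eps_g) * (a * P) <= (delta * K) * (a * P).
    by rewrite ler_wpM2r// mulr_ge0// ltW.
  lra.
(* The budget in units of [delta * (a * P * K)]: the margin provides 3/4, the two function errors
   cost at most 1/10 and the slope error at most 1/4. *)
have : delta * (3 / 4 * a * P * K) <= delta * (a * D).
  by rewrite ler_wpM2l// ltW.
have : 0 <= delta * (a * P * K) by rewrite !mulr_ge0// ltW.
rewrite /D; lra.
Qed.

(** The slope errors at the two ends of the step cost [(1 + c) * eps_g * P], at most half of
    [delta * P * K], while raising [c] by [delta] relaxes the bound by at least 3/4 of it, the slope
    being negative. *)
Lemma wolfe_transfer g1 g2 (eps_g K c delta a : R) x p :
  0 <= K -> 0 < c -> 0 < delta ->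
  (forall z, enorm (g1 z - g2 z) <= eps_g) ->
  2 * (1 + c) * eps_g <= delta * K ->
  3 / 4 * enorm p * K <= - dotv p (g2 x) ->
  wolfe_cond g1 c x p a -> wolfe_cond g2 (c + delta) x p a.
Proof.
move=> K0 c0 delta0 ge eg D2; rewrite /wolfe_cond => g1a.
have P0 := enorm_ge0 p.
have := dotv_error p (ge x); have := dotv_error p (ge (x + a *: p)).
rewrite !ler_norml => /andP[_ Da] /andP[D12 _].
set P := enorm p in P0 D2 D12 Da.
have E1 : c * - (eps_g * P) <= c * (dotv p (g1 x) - dotv p (g2 x)).
  by rewrite ler_wpM2l// ltW.
have E2 : (2 * (1 + c) * eps_g) * P <= (delta * K) * P by rewrite ler_wpM2r.
have E3 : delta * (3 / 4 * P * K) <= delta * - dotv p (g2 x).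
  by rewrite ler_wpM2l// ltW.
have : 0 <= delta * (P * K) by rewrite !mulr_ge0// ltW.
lra.
Qed.

End WolfeTransfer.

(** Squaring turns a lower bound on the gradient norm by an entry of [constA] into the bound on
    [eps_f] that [armijo_transfer] takes. *)
Lemma sqrt_div_sqr_le (R : realType) (u v e b N : R) :
  0 < v -> 0 <= u -> 0 <= e -> 0 < b ->
  Num.sqrt (u / v) * (Num.sqrt e / b) <= N -> u * e <= v * (b * N) ^+ 2.
Proof.
move=> v0 u0 e0 b0; rewrite mulrA ler_pdivrMr// -sqrtrM ?divr_ge0 ?(ltW v0)//.
move=> uN; have uv0 : 0 <= u / v * e by rewrite mulr_ge0// divr_ge0// ltW.
have : Num.sqrt (u / v * e) ^+ 2 <= (N * b) ^+ 2.
  by rewrite ler_sqr ?nnegrE ?sqrtr_ge0// (le_trans _ uN)// sqrtr_ge0.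
rewrite sqr_sqrtr// mulrAC ler_pdivrMr//; lra.
Qed.

Theorem theorem3p13 (R : realType) (d : nat)
  (phi : 'cV[R]_d -> R) (m M : R)
  (phi_bounded_below : has_lbound (range phi))
  (phi_C2 : twice_cont_differentiable phi)
  (M_gt0 : 0 < M) (grad_lipschitz : elipschitz M (grad phi))
  (m_gt0 : 0 < m) (m_le_M : m <= M) (phi_strong : strongly_convex m phi)
  (f : 'cV[R]_d -> R) (g : 'cV[R]_d -> 'cV[R]_d) (eps_f eps_g : R)
  (eps_f_ge0 : 0 <= eps_f) (eps_g_ge0 : 0 <= eps_g)
  (f_error : forall z, `|f z - phi z| <= eps_f)
  (g_error : forall z, enorm (g z - grad phi z) <= eps_g)
  (c1 c2 l : R) (c1_gt0 : 0 < c1) (c1_lt_c2 : c1 < c2) (c2_lt1 : c2 < 1)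
  (l_gt0 : 0 < l) (l_large : l > 2 * eps_g / m)
  (x0 : 'cV[R]_d) (H0 : 'M[R]_d) (H0_spd : symmetric_posdef H0)
  (x p s y : nat -> 'cV[R]_d) (H : nat -> 'M[R]_d) (alpha : nat -> R)
  (run : bfgs_with_errors f g c1 c2 l x0 H0 x p s y H alpha)
  (q : R) (q_gt0 : 0 < q) (q_lt1 : q < 1)
  (delta1 delta2 hdelta1 hdelta2 : R)
  (delta1_01 : 0 < delta1 < 1) (delta2_01 : 0 < delta2 < 1)
  (hdelta1_01 : 0 < hdelta1 < 1) (hdelta2_01 : 0 < hdelta2 < 1)
  (delta_sum : delta1 + delta2 < c2 - c1)
  (hdelta1_lt : hdelta1 < c1) (hdelta2_lt : hdelta2 < 1 - c2)
  (k : nat) :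
  let b1 := beta1 m M eps_g l q H0 in
  let A := constA c2 delta1 delta2 hdelta1 in
  let B := constB c1 c2 delta1 delta2 hdelta1 hdelta2 in
  good_iterates g x p b1 k ->
  enorm (grad phi (x k)) >=
    Num.max (A * (Num.sqrt (M * eps_f) / b1)) (B * (eps_g / b1)) ->
  [/\ exists2 a, 0 < a & armijo_wolfe f g c1 c2 (x k) (p k) a,
      forall a, 0 < a -> armijo_wolfe f g c1 c2 (x k) (p k) a ->
        armijo_wolfe phi (grad phi) (c1 - hdelta1) (c2 + hdelta2)
          (x k) (p k) a
    & phi (x k.+1) - phi (x k) <=
        - ((c1 - hdelta1) * (1 - (c2 + hdelta2)) * b1 ^+ 2 / (4 * M))
          * enorm (grad phi (x k)) ^+ 2].
Proof.
move=> b1 A B good; rewrite ge_max => /andP[HA HB].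
set G := grad phi in grad_lipschitz HA HB g_error *.
set N := enorm (G (x k)) in HA HB *.
set P := enorm (p k); pose K := b1 * N.
have b1_gt0 : 0 < b1 by exact: expR_gt0.
move: delta1_01 delta2_01 hdelta1_01 hdelta2_01.
move=> /andP[d1 d1'] /andP[d2 d2'] /andP[hd1 hd1'] /andP[hd2 hd2'].
(* Each entry [u / v] of the maximum [B] becomes a bound without denominators; [eA] below does the
   same for [A]. *)
have eps_bound u v : 0 < v -> u / v <= B -> u * eps_g <= v * K.
  move=> v0 uB; have : u / v * (eps_g / b1) <= N.
    by apply: le_trans HB; rewrite ler_wpM2r// divr_ge0// ltW.
  by rewrite mulf_div ler_pdivrMr ?mulr_gt0// /K; lra.
have eB1 : 4 * (c1 + delta1) * eps_g <= delta1 * K.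
  by apply: eps_bound => //; rewrite /B /constB !le_max lexx ?orbT.
have eB2 : 2 * (1 + c2 - delta2) * eps_g <= delta2 * K.
  by apply: eps_bound => //; rewrite /B /constB !le_max lexx ?orbT.
have eB3 : 8 * eps_g <= (1 - c2) * K.
  by apply: eps_bound; [lra|rewrite /B /constB !le_max lexx ?orbT].
have eB4 : 4 * c1 * eps_g <= hdelta1 * K.
  by apply: eps_bound => //; rewrite /B /constB !le_max lexx ?orbT.
have eB5 : 2 * (1 + c2) * eps_g <= hdelta2 * K.
  by apply: eps_bound => //; rewrite /B /constB !le_max lexx ?orbT.
have Me0 : 0 <= M * eps_f by rewrite mulr_ge0// ltW.
have eA u v : 0 < v -> 0 <= u -> Num.sqrt (u / v) <= A ->
    u * (M * eps_f) <= v * K ^+ 2.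
  move=> v0 u0 uA; apply: sqrt_div_sqr_le => //; apply: le_trans HA.
  by rewrite ler_wpM2r// divr_ge0 ?sqrtr_ge0// ltW.
have eA1 : 32 * M * eps_f <= (1 - c2 + delta2) * delta1 * K ^+ 2.
  rewrite -mulrA; apply: eA; rewrite ?mulr_gt0//; first by lra.
  by rewrite /A /constA le_max lexx.
have eA2 : 32 * M * eps_f <= (1 - c2) * hdelta1 * K ^+ 2.
  rewrite -mulrA; apply: eA; rewrite ?mulr_gt0//; first by lra.
  by rewrite /A /constA le_max (mulrC hdelta1) lexx orbT.
have gx0 : 0 < enorm (g (x k)).
  by rewrite lt_def enorm_eq0 (bfgs_g_neq0 run) enorm_ge0.
(* For [P = 0] the cosine evaluates to 0, since the inverse of 0 is 0, and could not reach
   [b1 > 0]. *)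
have P0 : 0 < P.
  rewrite lt_def enorm_ge0 andbT; apply/eqP => P0; move: good.
  by rewrite /good_iterates /= /cos_theta -/P P0 mul0r invr0 mulr0 leNgt b1_gt0.
have Dg : b1 * (P * enorm (g (x k))) <= - dotv (p k) (g (x k)).
  by move: good; rewrite /good_iterates /= /cos_theta ler_pdivlMr// mulr_gt0.
(* At a good iterate [b1] lies below a cosine, which Cauchy-Schwarz bounds by 1. *)
have b1_le1 : b1 <= 1.
  have := le_trans Dg (le_trans (ler_norm _) _).
  rewrite normrN => /(_ _ (dotv_cauchy_schwarz _ _)).
  by rewrite ger_pMl// mulr_gt0.
have Ng : N <= enorm (g (x k)) + eps_g.
  have := enorm_triangle (g (x k)) (G (x k) - g (x k)).
  rewrite addrC subrK => /le_trans; apply; rewrite lerD2l.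
  by rewrite -opprB -scaleN1r enormZ normrN1 mul1r.
have gN : enorm (g (x k)) <= N + eps_g.
  have := enorm_triangle (G (x k)) (g (x k) - G (x k)).
  by rewrite addrC subrK => /le_trans; apply; rewrite lerD2l.
have N0 : 0 <= N by exact: enorm_ge0.
(* If [N] were 0, [eB3] would make [eps_g] vanish and then [gN] would make [g (x k)] vanish, against
   [gx0]. *)
have K0 : 0 < K.
  rewrite mulr_gt0// lt_def N0 andbT; apply/eqP => N_0.
  by move: eB3; rewrite /K N_0 !mulr0; lra.
have eK : 8 * eps_g <= K by nra.
(* The angle condition is stated for [g]; replacing its norm by [N] costs one [eps_g], and replacing
   the slope of [g] by that of [G] costs a second one. With [eK] the factors are at least 7/8 and
   3/4 of [K]. *)
have DgK' : P * (K - eps_g) <= - dotv (p k) (g (x k)).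
  apply: le_trans Dg; rewrite mulrCA ler_pM2l// /K; nra.
have dotv_err z := dotv_error (p k) (g_error z).
have DK' : P * (K - 2 * eps_g) <= - dotv (p k) (G (x k)).
  by have := dotv_err (x k); rewrite ler_norml -/P => /andP[+ _]; lra.
have KP0 : 0 < K * P by rewrite mulr_gt0.
have eKP : 8 * eps_g * P <= K * P by rewrite ler_pM2r.
have DgK : 3 / 4 * P * K <= - dotv (p k) (g (x k)) by lra.
have DK : 3 / 4 * P * K <= - dotv (p k) (G (x k)) by lra.
have lips a : 0 < a -> dotv (p k) (G (x k + a *: p k)) - dotv (p k) (G (x k))
    <= (M * a * P) * P.
  by move=> a0; rewrite -[leRHS]mulrA -expr2; apply: dotv_lipschitz (ltW a0).
have phi_g z : enorm (G z - g z) <= eps_g.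
  by rewrite -opprB -scaleN1r enormZ normrN1 mul1r.
have phi_f z : `|phi z - f z| <= eps_f by rewrite distrC.
have exists_step : exists2 a, 0 < a & armijo_wolfe f g c1 c2 (x k) (p k) a.
  have dphi t : differentiable phi (x k + t *: p k) by case: phi_C2.
  (* The single parameter [c1 + delta1] suffices: it is below [c2 - delta2], so the slope equation
     at [a] implies the curvature condition with [c2 - delta2]. *)
  have [||||a a0 [arm wol]] := @wolfe_step_exists _
      (fun t => phi (x k + t *: p k))
      (fun t => dotv (p k) (G (x k + t *: p k))) (c1 + delta1).
  - by apply/andP; split; lra.
  - by move=> t; exact: is_derive_line.
  - by case: phi_bounded_below => L Lphi; exists L => _ [t _ <-]; apply: Lphi;
      exists (x k + t *: p k).
  - by rewrite scale0r addr0; lra.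
  move: arm wol; rewrite scale0r addr0 => arm wol.
  exists a => //; split.
    rewrite -[c1](addrK delta1).
    apply: (armijo_transfer M_gt0 K0 _ d1 a0 phi_f phi_g eB1 eA1 DgK _ arm);
      first by lra.
    (* Here [kappa] is [1 - c2 + delta2], which is below the actual relative slope change
       [1 - (c1 + delta1)]; the factor 3/4 of [DK] exceeds the required 5/8. *)
    have := lips a a0; rewrite wol => lipsa.
    rewrite -(ler_pM2r P0); apply: le_trans lipsa.
    have : (1 - (c1 + delta1)) * (3 / 4 * P * K) <=
           (1 - (c1 + delta1)) * - dotv (p k) (G (x k)).
      by rewrite ler_wpM2l//; lra.
    have : 0 <= (c2 - c1 - delta1 - delta2) * (K * P).
      by rewrite mulr_ge0//; lra.
    have : 0 <= (1 - c2 + delta2) * (K * P) by rewrite mulr_ge0//; lra.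
    lra.
  rewrite -[c2](subrK delta2).
  apply: (wolfe_transfer (ltW K0) _ d2 phi_g _ DgK); [lra|lra|].
  rewrite /wolfe_cond wol ler_wnM2r//; lra.
have exact_wolfe a : 0 < a -> armijo_wolfe f g c1 c2 (x k) (p k) a ->
    armijo_wolfe phi G (c1 - hdelta1) (c2 + hdelta2) (x k) (p k) a.
  move=> a0 [arm wol]; split.
    apply: (armijo_transfer M_gt0 K0 c1_gt0 hd1 a0 f_error g_error eB4 eA2 DK
      _ arm).
    rewrite -(ler_pM2r P0); apply: le_trans (lips a a0).
    have := dotv_err (x k); have := dotv_err (x k + a *: p k).
    rewrite !ler_norml => /andP[_ ea] /andP[ex _].
    move: wol ea ex; rewrite /wolfe_cond -/P => wol ea ex.
    have : (1 - c2) * (7 / 8 * P * K) <= (1 - c2) * - dotv (p k) (g (x k)).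
      by rewrite ler_wpM2l//; lra.
    (* The factor [1 - c2] in [eB3] makes the two slope errors at most 2/8 of [(1 - c2) * K * P],
       hence comparable with the curvature gap however small it is. *)
    have : 8 * eps_g * P <= (1 - c2) * K * P by rewrite ler_pM2r.
    lra.
  by apply: (wolfe_transfer (ltW K0) _ hd2 g_error eB5 DK wol); lra.
split=> //.
have [a0 aw] := bfgs_search run exists_step.
have [arm wol] := exact_wolfe _ a0 aw.
rewrite (bfgs_x run); move: arm wol (lips _ a0).
rewrite /armijo_cond /wolfe_cond.
set D := - dotv (p k) (G (x k)) in DK.
set a := alpha k in a0 *.
move=> arm wol lipsa.
set kappa := 1 - (c2 + hdelta2).
have kappa0 : 0 < kappa by rewrite /kappa; lra.
(* Curvature and the Lipschitz bound give [kappa * D <= M * a * P ^+ 2]. Multiplying by [D] and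
   using [D >= 3 / 4 * P * K] yields the constant 9/16, which is more than the 1/4 claimed. *)
have aD : kappa * K ^+ 2 / (4 * M) <= a * D.
  rewrite ler_pdivrMr ?mulr_gt0//.
  have E1 : kappa * D <= M * a * P ^+ 2 by rewrite /kappa /D; lra.
  have PK_ge0 : 0 <= 3 / 4 * P * K by lra.
  have D_ge0 : 0 <= D by exact: le_trans DK.
  have E2 : kappa * (3 / 4 * P * K) ^+ 2 <= kappa * D ^+ 2.
    by rewrite ler_pM2l// ler_sqr.
  have E3 : kappa * D * D <= M * a * P ^+ 2 * D.
    by rewrite ler_wpM2r.
  have P2 : 0 < P ^+ 2 by rewrite exprn_gt0.
  have E4 : 0 <= kappa * (K * P) ^+ 2 by rewrite mulr_ge0 ?sqr_ge0// ltW.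
  rewrite -(ler_pM2r P2); lra.
have : (c1 - hdelta1) * (kappa * K ^+ 2 / (4 * M)) <= (c1 - hdelta1) * (a * D).
  by rewrite ler_wpM2l//; lra.
move: arm; rewrite -[dotv (p k) (G (x k))]opprK -/D /K exprMn -/N; lra.
Qed.
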